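(* Let $m,r\ge1$ be integers, let $g(t)=\sum_{n\ge0}g_n\frac{t^n}{n!}$ be a formal power series with $g_0\ne0$, put $A(t)=1/g(t)$, let $\{A_n(x)\}_{n\ge0}$ be the Appell sequence for $g(t)$, and let ${}_{{}_LH^{(m,r)}}A_n(x,y,z)$ $(n\ge0)$ be the associated Laguerre-Gould Hopper based Appell polynomials. Then for every $n\ge0$ $${}_{{}_LH^{(m,r)}}A_n(x,y,z)=\exp\left(D_x^{-1}\frac{\partial^m}{\partial y^m}+z\frac{\partial^r}{\partial y^r}\right)A_n(y).$$
   Context: Coefficients are real (or complex) numbers. The Appell sequence for $g(t)$ is the sequence of polynomials defined by $A(t)e^{xt}=\sum_{n\ge0}A_n(x)\frac{t^n}{n!}$, $A(t)=1/g(t)$. The Laguerre-Gould Hopper based Appell polynomials are defined by the formal generating function $$A(t)\,C_0(-xt^m)\exp(yt+zt^r)=\sum_{n=0}^{\infty}{}_{{}_LH^{(m,r)}}A_n(x,y,z)\frac{t^n}{n!},$$ where $C_0(x)=\sum_{k\ge0}\frac{(-1)^kx^k}{(k!)^2}$ is the Bessel-Tricomi function of order zero. $D_x^{-1}$ is the inverse derivative operator acting on polynomials in $x$ (linearly over the other variables) by $D_x^{-1}\{x^k\}=\frac{x^{k+1}}{k+1}$; in particular $D_x^{-k}\{1\}=\frac{x^k}{k!}$, and $A_n(y)$ is regarded as constant in $x$. The exponential of an operator is given by its power series, which is a finite sum when applied to a polynomial in $y$. *)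

(* Defs.v *)
From HB Require Import structures.
From mathcomp Require Import all_boot all_order all_algebra.
From mathcomp.multinomials Require Import ssrcomplements mpoly.

Set Implicit Arguments.
Unset Strict Implicit.
Unset Printing Implicit Defensive.

Import Order.TTheory GRing.Theory Num.Theory.
Local Open Scope ring_scope.

(* A formal power series in t is its sequence of ordinary coefficients:       *)
(* f : fps K stands for \sum_n (f n) t^n.                                     *)
Definition fps (K : Type) := nat -> K.

Section FormalPowerSeries.

Variable K : pzRingType.
Implicit Types (f h : fps K) (a : K).

Definition fps_one : fps K := fun n => (n == 0%N)%:R.
Definition fps_monom a (d : nat) : fps K := fun n => if n == d then a else 0.
Definition fps_add f h : fps K := fun n => f n + h n.
Definition fps_mul f h : fps K := fun n => \sum_(i < n.+1) f i * h (n - i)%N.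
Definition fps_pow f (k : nat) : fps K := iter k (fps_mul f) fps_one.

End FormalPowerSeries.

Arguments fps_one {K}.

(* F(f(t)) = \sum_k F_k f(t)^k, for f with zero constant term: the sum for    *)
(* the coefficient of t^n then stops at k = n.                                *)
Definition fps_comp (R : pzRingType) (K : lalgType R) (F : fps R) (f : fps K) :
  fps K := fun n => \sum_(k < n.+1) F k *: fps_pow f k n.

Definition fps_lift (R : pzRingType) (K : lalgType R) (F : fps R) : fps K :=
  fun n => (F n)%:A.
Arguments fps_lift {R} K F.

Definition exp_series (R : unitRingType) : fps R := fun k => (k`!%:R)^-1.
Arguments exp_series {R}.

(* C_0 *)
Definition bessel_tricomi (R : unitRingType) : fps R :=
  fun k => (-1) ^+ k / (k`!%:R) ^+ 2.
Arguments bessel_tricomi {R}.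

Definition fps_exp (R : unitRingType) (K : lalgType R) (f : fps K) : fps K :=
  fps_comp exp_series f.

(* 1/f = f_0^-1 * 1/(1 - u) with u = 1 - f/f_0; see fps_mulV.                 *)
Definition fps_inv (R : fieldType) (f : fps R) : fps R :=
  let u : fps R^o := fun n => fps_one n - (f 0%N)^-1 * f n in
  fun n => (f 0%N)^-1 * fps_comp (fun=> 1) u n.

Section InverseCorrect.

Lemma fps_pow_small (K : pzRingType) (u : fps K) (k n : nat) :
  u 0%N = 0 -> (n < k)%N -> fps_pow u k n = 0.
Proof.
move=> u0; elim: k n => [//|k IH] n ltnk.
rewrite /fps_pow /= -/(fps_pow u k) /fps_mul big1 // => -[[|i] /= lti] _.
  by rewrite u0 mul0r.
rewrite IH ?mulr0 //.
by rewrite (leq_trans _ (_ : n <= k)%N) // ltn_subrL (leq_trans _ (ltnSE lti)).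
Qed.

Lemma fps_mulV (R : fieldType) (f : fps R) :
  f 0%N != 0 -> fps_mul f (fps_inv f) =1 fps_one.
Proof.
move=> f0 n; rewrite /fps_inv.
pose u : fps R^o := fun n => fps_one n - (f 0%N)^-1 * f n; rewrite -/u.
have u0 : u 0%N = 0 by rewrite /u /fps_one /= mulVf ?subrr.
have fE i : f i * (f 0%N)^-1 = fps_one i - u i.
  by rewrite /u subKr mulrC.
have geo i : (i <= n)%N ->
    fps_comp (fun=> 1) u (n - i)%N = \sum_(k < n.+1) fps_pow u k (n - i)%N.
  move=> lein; rewrite /fps_comp (eq_bigr _ (fun k _ => scale1r _)).
  rewrite (big_ord_widen n.+1 (fun k => fps_pow u k (n - i)%N)); last first.
    by rewrite ltnS leq_subr.
  rewrite [RHS](bigID (fun k : 'I_n.+1 => (k < (n - i).+1)%N)) /=.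
  rewrite [X in _ + X]big1 ?addr0 // => k; rewrite -leqNgt => ltk.
  exact: fps_pow_small.
rewrite /fps_mul (eq_bigr (fun i : 'I_n.+1 => \sum_(k < n.+1)
  (fps_one i * fps_pow u k (n - i)%N - u i * fps_pow u k (n - i)%N))); last first.
  move=> i _; rewrite mulrA fE geo; last by rewrite -ltnS.
  by rewrite mulr_sumr; apply: eq_bigr => k _; rewrite mulrBl.
rewrite exchange_big /=.
rewrite (eq_bigr (fun k : 'I_n.+1 => - (fps_pow u k.+1 n - fps_pow u k n))).
  rewrite sumrN -(big_mkord xpredT (fun k => fps_pow u k.+1 n - fps_pow u k n)).
  by rewrite telescope_sumr // opprB (@fps_pow_small _ u n.+1 n) // subr0.
move=> k _; rewrite sumrB opprB; congr (_ - _).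
rewrite big_ord_recl /= subn0 /fps_one eqxx mul1r big1 ?addr0 // => i _.
by rewrite mul0r.
Qed.

End InverseCorrect.

(* A(t) = 1/g(t), where g(t) = \sum_n g_n t^n/n!                              *)
Definition appell_A (R : fieldType) (g : nat -> R) : fps R :=
  fps_inv (fun n => g n / n`!%:R).

(* A_n, read off A(t) e^(xt) = \sum_n A_n(x) t^n/n!                           *)
Definition appell (R : fieldType) (g : nat -> R) (n : nat) : {poly R} :=
  n`!%:R *: fps_mul (fps_lift {poly R} (appell_A g))
                    (fps_exp (fps_monom 'X 1)) n.

Lemma appellP (R : numFieldType) (g : nat -> R) (n : nat) :
  fps_mul (fps_lift {poly R} (appell_A g)) (fps_exp (fps_monom 'X 1)) n =
  (n`!%:R)^-1 *: appell g n.
Proof. by rewrite scalerA mulVf ?scale1r // pnatr_eq0 -lt0n fact_gt0. Qed.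

(* The variables x, y, z of {mpoly R[3]} *)
Definition vx : 'I_3 := @Ordinal 3 0 isT.
Definition vy : 'I_3 := @Ordinal 3 1 isT.
Definition vz : 'I_3 := @Ordinal 3 2 isT.

(* The Laguerre-Gould Hopper based Appell polynomials, read off               *)
(* A(t) C_0(-x t^m) exp(y t + z t^r) = \sum_n (lgh_appell m r g n) t^n/n!     *)
Definition lgh_appell (R : fieldType) (m r : nat) (g : nat -> R) (n : nat) :
  {mpoly R[3]} :=
  n`!%:R *:
    fps_mul (fps_mul (fps_lift {mpoly R[3]} (appell_A g))
                     (fps_comp bessel_tricomi (fps_monom (- 'X_vx) m)))
            (fps_exp (fps_add (fps_monom 'X_vy 1) (fps_monom 'X_vz r))) n.

Lemma lgh_appellP (R : numFieldType) (m r : nat) (g : nat -> R) (n : nat) :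
  fps_mul (fps_mul (fps_lift {mpoly R[3]} (appell_A g))
                   (fps_comp bessel_tricomi (fps_monom (- 'X_vx) m)))
          (fps_exp (fps_add (fps_monom 'X_vy 1) (fps_monom 'X_vz r))) n =
  (n`!%:R)^-1 *: lgh_appell m r g n.
Proof. by rewrite scalerA mulVf ?scale1r // pnatr_eq0 -lt0n fact_gt0. Qed.

(* The inverse derivative D_i^{-1}: see mpoly_integX and mpoly_integ_linear. *)
Definition mpoly_integ (R : fieldType) (i : 'I_3) (p : {mpoly R[3]}) :
  {mpoly R[3]} :=
  \sum_(a <- msupp p) (p@_a / (a i).+1%:R) *: 'X_[a + U_(i)].

Lemma mpoly_integX (R : fieldType) (i : 'I_3) (a : 'X_{1..3}) :
  mpoly_integ i ('X_[a] : {mpoly R[3]}) = ((a i).+1%:R)^-1 *: 'X_[a + U_(i)].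
Proof. by rewrite /mpoly_integ msuppX big_seq1 mcoeffX eqxx mul1r. Qed.

Lemma mpoly_integ_linear (R : fieldType) (i : 'I_3) :
  linear (@mpoly_integ R i).
Proof.
move=> c p q.
pose d := maxn (msize (c *: p + q)) (maxn (msize p) (msize q)).
have E s : (msize s <= d)%N -> mpoly_integ i s =
    \sum_(a : 'X_{1..3 < d}) (s@_a / (a i).+1%:R) *: 'X_[a + U_(i)].
  move=> les; pose I : subFinType _ := 'X_{1..3 < d}.
  rewrite /mpoly_integ (big_mksub I) /=; first last.
  - by move=> a /msize_mdeg_lt/leq_trans/(_ les).
  - by rewrite msupp_uniq.
  rewrite big_rmcond //= => a /memN_msupp_eq0 ->.
  by rewrite mul0r scale0r.
rewrite !E ?scaler_sumr -?big_split /=.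
- apply: eq_bigr => a _.
  by rewrite mcoeffD mcoeffZ scalerA -scalerDl mulrDl mulrA.
all: by rewrite /d ?leq_max ?leqnn ?orbT.
Qed.

(* q = exp(T) p, with exp(T) p = \sum_k T^k p / k! a finite sum               *)
Definition is_op_exp (R : fieldType) (V : lmodType R) (T : V -> V) (p q : V) :
  Prop :=
  exists2 N : nat, forall k : nat, (N <= k)%N -> iter k T p = 0
    & q = \sum_(k < N) (k`!%:R)^-1 *: iter k T p.

Lemma is_op_exp_uniq (R : fieldType) (V : lmodType R) (T : V -> V)
  (p q q' : V) : is_op_exp T p q -> is_op_exp T p q' -> q = q'.
Proof.
move=> [N TN ->] [M TM ->].
wlog leNM : N M TN TM / (N <= M)%N => [W|].
  by case/orP: (leq_total N M) => le; [|symmetry]; apply: W.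
rewrite (big_ord_widen M (fun k => (k`!%:R)^-1 *: iter k T p)) //.
rewrite [RHS](bigID (fun k : 'I_M => (k < N)%N)) /=.
rewrite [X in _ = _ + X]big1 ?addr0 // => k; rewrite -leqNgt => leNk.
by rewrite TN ?scaler0.
Qed.

(* Main.v *)
(** The operators [D_x^-1 d_y^m] and [z d_y^r] commute, so on the divided power
[y^n/n!] the k-th iterate of their sum is [k!] times the sum over [i + l = k]
of [x^i/(i!)^2 * z^l/l! * y^j/j!] with [j + m i + r l = n].  Summed over [k],
these are the coefficients of [t^n] in [C_0(-x t^m) exp(y t + z t^r)]; the
factor [A(t)] is then put in by linearity. *)
From HB Require Import structures.
Require Import Defs.
From mathcomp Require Import all_boot all_order all_algebra.
From mathcomp Require Import ring.
From mathcomp.multinomials Require Import mpoly.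

Set Implicit Arguments.
Unset Strict Implicit.
Unset Printing Implicit Defensive.

Import Order.TTheory GRing.Theory Num.Theory.
Local Open Scope ring_scope.

(** * Reindexing of finite sums *)

Lemma sum_antidiagonals (V : nmodType) (N : nat) (F : nat -> nat -> V) :
  (forall i l, (N <= i + l)%N -> F i l = 0) ->
  \sum_(k < N) \sum_(i < k.+1) F i (k - i)%N = \sum_(i < N) \sum_(l < N) F i l.
Proof.
move=> F0.
transitivity
  (\sum_(k < N) \sum_(i < N) if (i <= k)%N then F i (k - i)%N else 0).
  apply: eq_bigr => k _; rewrite -big_mkcond /=.
  by rewrite (big_ord_widen N (fun i => F i (k - i)%N)).
rewrite exchange_big /=; apply: eq_bigr => i _.
(* A dummy index [l] pinned to [k - i] lets the sum over [k] move inside; there [k] is forced to be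
   [i + l]. *)
transitivity (\sum_(k < N) \sum_(l < N)
    if l == (k - i)%N :> nat then if (i <= k)%N then F i l else 0 else 0).
  apply: eq_bigr => k _; rewrite -big_mkcond /=.
  rewrite (big_ord1_eq _ (fun l => if (i <= k)%N then F i l else 0)).
  by rewrite (leq_ltn_trans (leq_subr _ _)).
rewrite exchange_big /=; apply: eq_bigr => l _.
transitivity (\sum_(k < N | k == (i + l)%N :> nat) F i l).
  rewrite [RHS]big_mkcond /=; apply: eq_bigr => k _.
  have [leik|ltki] := leqP i k; last first.
    by rewrite if_same ifN // neq_ltn ltn_addr.
  by rewrite -(eqn_add2l i) subnKC // eq_sym.
(* If [i + l] falls outside the range, the inner sum is empty and the hypothesis makes [F i l] zero
   as well. *)
rewrite (big_ord1_eq _ (fun=> F i l)); case: ltnP => // le.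
by rewrite F0.
Qed.

Lemma sum_ord_widen (V : nmodType) (n N : nat) (F : nat -> V) :
  (n <= N)%N -> (forall i, (n <= i)%N -> F i = 0) ->
  \sum_(i < n) F i = \sum_(i < N) F i.
Proof.
move=> lenN F0; rewrite (big_ord_widen N F) // big_mkcond /=.
by apply: eq_bigr => i _; case: ltnP => // /F0.
Qed.

Lemma natf_fact_neq0 (R : numFieldType) (n : nat) : n`!%:R != 0 :> R.
Proof. by rewrite pnatr_eq0 -lt0n fact_gt0. Qed.

(** * Formal power series computed through polynomials *)

Lemma fps_pow_coef (K : nzRingType) (p : {poly K}) (f : fps K) (k n : nat) :
  f =1 nth 0 p -> fps_pow f k n = (p ^+ k)`_n.
Proof.
move=> fp; elim: k n => [|k IH] n; first by rewrite coef1.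
rewrite exprS coefM /fps_pow /= -/(fps_pow f k) /fps_mul.
by apply: eq_bigr => i _; rewrite fp IH.
Qed.

(** The coefficient of [t^n] sees only terms of degree at most [n], so truncating both factors is
    harmless and the ring laws of [{poly K}] become available. *)
Lemma fps_mul_coef (K : nzRingType) (N : nat) (f h : fps K) (n : nat) :
  (n < N)%N ->
  fps_mul f h n = ((\poly_(i < N) f i) * (\poly_(i < N) h i))`_n.
Proof.
move=> ltnN; rewrite coefM; apply: eq_bigr => i _.
rewrite !coef_poly (leq_ltn_trans (leq_subr _ _) ltnN).
by rewrite (leq_ltn_trans _ ltnN) // -ltnS.
Qed.

Lemma fps_mulA (K : nzRingType) (f g h : fps K) :
  fps_mul (fps_mul f g) h =1 fps_mul f (fps_mul g h).
Proof.
move=> n.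
pose P (u : fps K) := \poly_(i < n.+1) u i.
have PM u v i : (i <= n)%N -> (P (fps_mul u v))`_i = (P u * P v)`_i.
  by move=> lein; rewrite coef_poly ltnS lein (@fps_mul_coef _ n.+1).
rewrite !(@fps_mul_coef _ n.+1) // -!/(P _).
transitivity ((P f * P g * P h)`_n).
  by rewrite !coefM; apply: eq_bigr => i _; rewrite PM // -ltnS.
by rewrite -mulrA !coefM; apply: eq_bigr => i _; rewrite PM // leq_subr.
Qed.

Lemma fps_comp_monom (R : comNzRingType) (K : comAlgType R) (F : fps R) (a : K)
    (d n : nat) :
  fps_comp F (fps_monom a d) n =
  \sum_(k < n.+1) if n == (d * k)%N then F k *: a ^+ k else 0.
Proof.
apply: eq_bigr => k _; rewrite (@fps_pow_coef _ (a *: 'X^d)).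
  rewrite exprZn -exprM coefZ coefXn.
  by case: eqP; rewrite ?mulr1 // mulr0 scaler0.
move=> i; rewrite coefZ coefXn /fps_monom.
by case: eqP; rewrite ?mulr1 // mulr0.
Qed.

Lemma fps_exp_monom1 (R : fieldType) (K : comAlgType R) (a : K) (n : nat) :
  fps_exp (fps_monom a 1) n = (n`!%:R)^-1 *: a ^+ n.
Proof.
rewrite /fps_exp fps_comp_monom big_ord_recr /= mul1n eqxx.
rewrite big1 ?add0r // => k _.
by rewrite mul1n ifN // neq_ltn ltn_ord orbT.
Qed.

(** By the binomial theorem, [(a t + b t^r)^k / k!] is a sum of [a^j b^l t^(j + r l) / (j! l!)] over
    [j + l = k]; summing over [k] frees [j] and [l], and the degree [n] fixes [j]. The bound [N] is
    left free so that all coefficients can share one summation range. *)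
Lemma fps_exp_binom (R : numFieldType) (K : comAlgType R) (a b : K)
    (r n N : nat) :
  (0 < r)%N -> (n < N)%N ->
  fps_exp (fps_add (fps_monom a 1) (fps_monom b r)) n =
  \sum_(l < N) if (r * l <= n)%N
    then (l`!%:R * (n - r * l)`!%:R)^-1 *: (a ^+ (n - r * l) * b ^+ l) else 0.
Proof.
move=> r_gt0 ltnN.
have ler l : (l <= r * l)%N by rewrite leq_pmull.
pose G l j : K := if n == (j + r * l)%N
  then (l`!%:R * j`!%:R)^-1 *: (a ^+ j * b ^+ l) else 0.
transitivity (\sum_(k < n.+1) \sum_(l < k.+1) G l (k - l)%N).
  apply: eq_bigr => k _.
  rewrite (@fps_pow_coef _ (a *: 'X + b *: 'X^r)); last first.
    move=> i; rewrite coefD !coefZ coefX coefXn /fps_add /fps_monom.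
    by congr (_ + _); case: eqP; rewrite ?mulr1 // mulr0.
  rewrite exprDn coef_sum scaler_sumr; apply: eq_bigr => -[l /= ltl] _.
  rewrite coefMn !exprZn -scalerAl -scalerAr scalerA -exprM -exprD coefZ coefXn.
  rewrite /G; case: eqP => _; last by rewrite mulr0 mul0rn scaler0.
  rewrite mulr1 -scaler_nat scalerA; congr (_ *: _).
  (* Clearing [k!] reduces the claim to [bin_fact]. *)
  apply: (canLR (mulKf (natf_fact_neq0 R k))).
  rewrite -(bin_fact (ltnSE ltl)) 2!natrM mulfK // mulf_neq0 //;
    exact: natf_fact_neq0.
rewrite sum_antidiagonals => [|l j ltn]; last first.
  rewrite /G ifN // neq_ltn (leq_trans ltn) // addnC leq_add2l.
  exact: ler.
rewrite -(@sum_ord_widen _ n.+1 N (fun l => if (r * l <= n)%N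
    then (l`!%:R * (n - r * l)`!%:R)^-1 *: (a ^+ (n - r * l) * b ^+ l)
    else 0)) // => [|l ltl]; last by rewrite leqNgt (leq_trans ltl).
apply: eq_bigr => l _.
have [le|lt] := leqP (r * l)%N n; last first.
  by rewrite big1 // => j _; rewrite /G ifN // neq_ltn ltn_addl.
transitivity (\sum_(j < n.+1 | j == (n - r * l)%N :> nat)
    (l`!%:R * j`!%:R)^-1 *: (a ^+ j * b ^+ l)); last first.
  rewrite (big_ord1_eq _ (fun j => (l`!%:R * j`!%:R)^-1 *: (a ^+ j * b ^+ l))).
  by rewrite ltnS leq_subr.
rewrite [RHS]big_mkcond /=; apply: eq_bigr => j _.
have -> // : (j == n - r * l :> nat)%N = (n == j + r * l)%N.
by rewrite -(eqn_add2r (r * l)%N) subnK // eq_sym.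
Qed.

(** This is the scalar produced by differentiating the divided power [y^n/n!] [k] times. *)
Lemma ffact_divn (R : numFieldType) (n k : nat) :
  (k <= n)%N ->
  (n ^_ k)%:R / n`!%:R = ((n - k)`!%:R)^-1 :> R.
Proof.
move=> lekn; rewrite -(ffact_fact lekn) natrM invfM mulrA mulfV ?mul1r //.
by rewrite pnatr_eq0 -lt0n ffact_gt0.
Qed.

Lemma mpoly_integ0 (R : fieldType) (v : 'I_3) :
  mpoly_integ v (0 : {mpoly R[3]}) = 0.
Proof. by rewrite /mpoly_integ msupp0 big_nil. Qed.

Lemma mpoly_integZ (R : fieldType) (v : 'I_3) (c : R) (p : {mpoly R[3]}) :
  mpoly_integ v (c *: p) = c *: mpoly_integ v p.
Proof. by rewrite -[c *: p]addr0 mpoly_integ_linear mpoly_integ0 addr0. Qed.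

(** * The operator on divided powers of [y], and the generating function without the factor
    [A(t)] *)

Section LaguerreGouldHopper.

Variables (R : numFieldType) (m r : nat).
Hypotheses (m_gt0 : (0 < m)%N) (r_gt0 : (0 < r)%N).

Definition lgh_op (p : {mpoly R[3]}) : {mpoly R[3]} :=
  mpoly_integ vx (p^`M(vy, m)) + 'X_vz * p^`M(vy, r).

Lemma lgh_op_linear : linear lgh_op.
Proof.
move=> c p q; rewrite /lgh_op !linearP mpoly_integ_linear /=.
by rewrite mulrDr -scalerAr scalerDr addrACA.
Qed.

HB.instance Definition _ :=
  GRing.isLinear.Build R {mpoly R[3]} {mpoly R[3]} _ lgh_op lgh_op_linear.

Definition xyz_mnm (i j l : nat) : 'X_{1..3} :=
  (U_(vx) *+ i + U_(vy) *+ j + U_(vz) *+ l)%MM.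

(** The term [x^i/(i!)^2 * z^l/l! * y^j/j!] with [j = n - m i - r l]. The test discards the cases
    where truncated subtraction would replace a negative [j] by 0. *)
Definition lgh_coef (n i l : nat) : {mpoly R[3]} :=
  if (m * i + r * l <= n)%N
  then (i`!%:R ^+ 2 * l`!%:R * (n - (m * i + r * l))`!%:R)^-1 *:
         'X_[xyz_mnm i (n - (m * i + r * l)) l]
  else 0.

(** On divided powers of [y] a derivative only shifts the index: [ffact_divn] absorbs the falling
    factorial, which is zero when [d] exceeds the degree in [y]. *)
Lemma lgh_coef_mderiv (n i l d : nat) :
  (lgh_coef n i l)^`M(vy, d) =
  if (m * i + r * l + d <= n)%N
  then (i`!%:R ^+ 2 * l`!%:R * (n - (m * i + r * l + d))`!%:R)^-1 *:
         'X_[xyz_mnm i (n - (m * i + r * l + d)) l]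
  else 0.
Proof.
rewrite /lgh_coef; set s := (m * i + r * l)%N.
have [le|lt] := leqP s n; last first.
  by rewrite linear0 ifN // -ltnNge ltn_addr.
rewrite linearZ /= mderivnX subnDA -leq_subRL //.
have -> : xyz_mnm i (n - s) l vy = (n - s)%N.
  by rewrite /xyz_mnm !mnmDE !mulmnE !mnm1E /= !mul0n mul1n addn0.
have [led|ltd] := leqP d (n - s)%N; last first.
  by rewrite ffact_small // scale0r scaler0.
rewrite scalerA mulrC invfM mulrCA ffact_divn // -invfM.
congr (_ *: 'X_[_]); apply/mnmP => k.
rewrite !(mnmDE, mnmBE, mulmnE, mnm1E).
by case: k => [[|[|[|]]]] //= ?; rewrite !(mul0n, mul1n, subn0, addn0, add0n).
Qed.

(** Integration in [x] contributes [1/(i+1)], whereas [(i!)^2] must grow by [(i+1)^2]; the surplus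
    is the weight [i+1]. Multiplication by [z] contributes no scalar, and passing from [l!] to
    [(l+1)!] leaves the weight [l+1]. *)
Lemma lgh_op_coef (n i l : nat) :
  lgh_op (lgh_coef n i l) =
  lgh_coef n i.+1 l *+ i.+1 + lgh_coef n i l.+1 *+ l.+1.
Proof.
rewrite /lgh_op !lgh_coef_mderiv; congr (_ + _).
  rewrite /lgh_coef mulnS addnC addnA.
  case: leqP => _; last by rewrite mpoly_integ0 mul0rn.
  rewrite mpoly_integZ mpoly_integX scalerA scalerMnl; congr (_ *: 'X_[_]).
    have -> : xyz_mnm i (n - (m + m * i + r * l)) l vx = i.
      by rewrite /xyz_mnm !mnmDE !mulmnE !mnm1E /= !mul0n mul1n !addn0.
    rewrite factS natrM -[RHS]mulr_natr; field.
    by rewrite nat1r !natf_fact_neq0 pnatr_eq0.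
  apply/mnmP => k; rewrite !(mnmDE, mulmnE, mnm1E).
  by case: k => [[|[|[|]]]] //= ?; rewrite !(mul0n, mul1n, addn0, add0n, addn1).
rewrite /lgh_coef mulnS [(r + _)%N]addnC addnA.
case: leqP => _; last by rewrite mulr0 mul0rn.
rewrite -scalerAr -mpolyXD scalerMnl; congr (_ *: 'X_[_]).
  rewrite factS natrM -[RHS]mulr_natr; field.
  by rewrite nat1r !natf_fact_neq0 pnatr_eq0.
apply/mnmP => k; rewrite !(mnmDE, mulmnE, mnm1E).
by case: k => [[|[|[|]]]] //= ?; rewrite !(mul0n, mul1n, addn0, add0n, add1n).
Qed.

(** The term at [(i, l)] with [i + l = k+1] is reached from [(i-1, l)] with weight [i] and from
    [(i, l-1)] with weight [l]. The weights add up to [k+1], which builds the factorial. *)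
Lemma iter_lgh_op (n k : nat) :
  iter k lgh_op (lgh_coef n 0 0) =
  (\sum_(i < k.+1) lgh_coef n i (k - i)) *+ k`!.
Proof.
elim: k => [|k IH]; first by rewrite big_ord1.
rewrite iterS IH linearMn linear_sum /= factS mulrnA; congr (_ *+ _).
under eq_bigr do rewrite lgh_op_coef; rewrite -sumrMnl big_split /=.
transitivity (\sum_(i < k.+2)
  (lgh_coef n i (k.+1 - i) *+ i + lgh_coef n i (k.+1 - i) *+ (k.+1 - i))).
  (* The boundary terms [i = 0] and [i = k+1] carry weight 0, so both sums extend to the same
     range. *)
  rewrite [RHS]big_split /= [X in _ = X + _]big_ord_recl mulr0n add0r.
  congr (_ + _).
  rewrite [RHS]big_ord_recr /= subnn mulr0n addr0.
  by apply: eq_bigr => i _; rewrite subSn // -ltnS.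
by apply: eq_bigr => -[i /= lti] _; rewrite -mulrnDr subnKC.
Qed.

(** Since [m] and [r] are positive, [i + l <= m i + r l]. *)
Lemma lgh_coef_eq0 (n i l : nat) : (n < i + l)%N -> lgh_coef n i l = 0.
Proof.
move=> lt; rewrite /lgh_coef ifN // -ltnNge (leq_trans lt) //.
by rewrite leq_add ?leq_pmull.
Qed.

Lemma iter_lgh_op_eq0 (n k : nat) :
  (n < k)%N -> iter k lgh_op (lgh_coef n 0 0) = 0.
Proof.
move=> ltnk; rewrite iter_lgh_op big1 ?mul0rn // => i _.
by rewrite lgh_coef_eq0 // subnKC // -ltnS.
Qed.

Lemma lgh_coef00 n : lgh_coef n 0 0 = (n`!%:R)^-1 *: 'X_vy ^+ n.
Proof.
rewrite /lgh_coef !muln0 subn0 expr1n !mul1r mpolyXn; congr (_ *: 'X_[_]).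
apply/mnmP => k; rewrite !(mnmDE, mulmnE, mnm1E).
by rewrite !muln0 addn0.
Qed.

Definition lgh_base (n : nat) : {mpoly R[3]} :=
  fps_mul (fps_comp bessel_tricomi (fps_monom (- 'X_vx) m))
          (fps_exp (fps_add (fps_monom 'X_vy 1) (fps_monom 'X_vz r))) n.

Lemma lgh_baseE n :
  lgh_base n = \sum_(i < n.+1) \sum_(l < n.+1) lgh_coef n i l.
Proof.
pose E q : {mpoly R[3]} :=
  fps_exp (fps_add (fps_monom 'X_vy 1) (fps_monom 'X_vz r)) q.
pose B (q i : nat) : {mpoly R[3]} :=
  if q == (m * i)%N then ((i`!%:R)^-2) *: 'X_vx ^+ i else 0.
transitivity (\sum_(q < n.+1) \sum_(i < n.+1) B q i * E (n - q)%N).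
  apply: eq_bigr => q _.
  rewrite -mulr_suml; congr (_ * _); rewrite fps_comp_monom.
  rewrite -(@sum_ord_widen _ q.+1 n.+1 (B q)) // => [|i lti]; last first.
    by rewrite /B ifN // neq_ltn (leq_trans lti) // leq_pmull.
  apply: eq_bigr => i _; rewrite /B; case: eqP => // _.
  (* The sign of the Bessel-Tricomi coefficient cancels that of [(-x)^i]. *)
  rewrite -scaleN1r exprZn scalerA /bessel_tricomi mulrAC -expr2 sqrr_sign.
  by rewrite mul1r.
rewrite exchange_big /=; apply: eq_bigr => i _.
transitivity (\sum_(q < n.+1 | q == (m * i)%N :> nat)
   ((i`!%:R)^-2 *: 'X_vx ^+ i) * E (n - q)%N).
  rewrite [RHS]big_mkcond; apply: eq_bigr => q _; rewrite /B.
  by case: eqP; rewrite ?mul0r.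
rewrite (big_ord1_eq _ (fun q => ((i`!%:R)^-2 *: 'X_vx ^+ i) * E (n - q)%N)).
(* If [m i > n], the degree [q = m i] is out of range, and every [lgh_coef n i l] is zero too. *)
rewrite ltnS; have [le|lt] := leqP; last first.
  by rewrite big1 // => l _; rewrite /lgh_coef ifN // -ltnNge ltn_addr.
rewrite /E (@fps_exp_binom _ _ _ _ _ _ n.+1) // ?ltnS ?leq_subr // mulr_sumr.
apply: eq_bigr => l _; rewrite leq_subRL // /lgh_coef -subnDA.
case: leqP => _; last by rewrite mulr0.
rewrite -scalerAl -scalerAr scalerA !mpolyXn -!mpolyXD; congr (_ *: 'X_[_]).
  by rewrite -invfM mulrA mulrAC.
by rewrite /xyz_mnm addmA.
Qed.

Lemma is_op_exp_lgh_base n :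
  is_op_exp lgh_op ((n`!%:R)^-1 *: 'X_vy ^+ n) (lgh_base n).
Proof.
rewrite -lgh_coef00; exists n.+1 => [k|]; first exact: iter_lgh_op_eq0.
rewrite lgh_baseE -(sum_antidiagonals (@lgh_coef_eq0 n)).
apply: eq_bigr => k _.
by rewrite iter_lgh_op -scaler_nat scalerA mulVf ?scale1r ?natf_fact_neq0.
Qed.

End LaguerreGouldHopper.

(** * Linearity of the exponential of a linear operator *)

Section OperatorExponential.

Variables (R : fieldType) (V : lmodType R) (T : {linear V -> V}).

Lemma iter_linear (k : nat) : linear (iter k T).
Proof. by elim: k => [|k IH] c p q //=; rewrite IH linearP. Qed.

Lemma is_op_exp_linear c p q p' q' :
  is_op_exp T p q -> is_op_exp T p' q' ->
  is_op_exp T (c *: p + p') (c *: q + q').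
Proof.
(* Both finite sums are padded with zero terms to a common length. *)
move=> [N TN ->] [M TM ->]; exists (maxn N M) => [k|].
  by rewrite geq_max iter_linear => /andP[/TN-> /TM->]; rewrite scaler0 addr0.
rewrite (@sum_ord_widen _ N (maxn N M) (fun k => (k`!%:R)^-1 *: iter k T p));
  first last.
- by move=> k /TN->; rewrite scaler0.
- exact: leq_maxl.
rewrite (@sum_ord_widen _ M (maxn N M) (fun k => (k`!%:R)^-1 *: iter k T p'));
  first last.
- by move=> k /TM->; rewrite scaler0.
- exact: leq_maxr.
rewrite scaler_sumr -big_split /=; apply: eq_bigr => k _.
by rewrite iter_linear scalerDr !scalerA mulrC.
Qed.

Lemma is_op_exp0 : is_op_exp T 0 0.
Proof.
exists 0%N => [k _|]; last by rewrite big_ord0.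
by elim: k => //= k ->; rewrite linear0.
Qed.

Lemma is_op_exp_sum (n : nat) (c : nat -> R) (p q : nat -> V) :
  (forall i, is_op_exp T (p i) (q i)) ->
  is_op_exp T (\sum_(i < n) c i *: p i) (\sum_(i < n) c i *: q i).
Proof.
move=> pq; elim: n => [|n IH]; first by rewrite !big_ord0; exact: is_op_exp0.
rewrite !big_ord_recr /= addrC [X in is_op_exp _ _ X]addrC.
by apply: is_op_exp_linear.
Qed.

End OperatorExponential.

Theorem theorem2p4 (R : numFieldType) (m r : nat) (hm : (1 <= m)%N)
    (hr : (1 <= r)%N) (g : nat -> R) (hg : g 0%N != 0) (n : nat) :
  is_op_exp
    (fun p : {mpoly R[3]} =>
       mpoly_integ vx (p^`M(vy, m)) + 'X_vz * p^`M(vy, r))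
    (horner_alg 'X_vy (appell g n))
    (lgh_appell m r g n).
Proof.
(* The same scalars expand both sides: [A_n(y)] over the divided powers of [y], and the generating
   function's coefficient over [lgh_base]. *)
pose c i := n`!%:R * appell_A g i.
have -> : horner_alg 'X_vy (appell g n) =
    \sum_(i < n.+1)
      c i *: (((n - i)`!%:R)^-1 *: 'X_vy ^+ (n - i) : {mpoly R[3]}).
  rewrite /appell /fps_mul scaler_sumr linear_sum.
  apply: eq_bigr => i _; rewrite fps_exp_monom1 /fps_lift.
  rewrite -scalerAl mul1r !scalerA linearZ /= mulr_algl.
  by rewrite rmorphXn /= horner_algX.
(* Associativity of the series product isolates the factor [A(t)]. *)
have -> : lgh_appell m r g n = \sum_(i < n.+1) c i *: lgh_base R m r (n - i).
  rewrite /lgh_appell fps_mulA /fps_mul scaler_sumr; apply: eq_bigr => i _.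
  by rewrite /fps_lift -scalerAl mul1r scalerA.
exact: (@is_op_exp_sum R {mpoly R[3]} (lgh_op m r) n.+1 c _ _
  (fun i => is_op_exp_lgh_base R hm hr (n - i))).
Qed.
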